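(* Let $K$ be a number field with ideal class group $\mathcal{C}l_K=\{\mathfrak{C}_i\}$, and let $\mathfrak{I}$ denote the class of principal ideals. Let $n\in\mathcal{O}_K$ be a nonzero nonunit, and write $(n)=\prod_{(i,j)\in T}\mathfrak{p}_{ij}$, where $T$ is a finite index set and the $\mathfrak{p}_{ij}$ are (not necessarily distinct) prime ideals with $\mathfrak{p}_{ij}\in\mathfrak{C}_i$. For each $i$, let $K_i$ be a principalization field for $\mathfrak{C}_i$, and choose $\alpha_{ij}\in\mathcal{O}_{K_i}$ with $\mathfrak{p}_{ij}\mathcal{O}_{K_i}=(\alpha_{ij})$. Let $L=\prod_i K_i$ be the compositum. Then the factorizations of $n$ into irreducibles of $\mathcal{O}_K$ are precisely the factorizations $n=\prod_l\beta_l$ (with $\beta_l\in\mathcal{O}_K$) such that $\prod_l\beta_l$ is associate in $\mathcal{O}_L$ to $\prod_{(i,j)\in T}\alpha_{ij}$ and each $\beta_l$ is associate in $\mathcal{O}_L$ to $\prod_{(i,j)\in S}\alpha_{ij}$ for some minimal nonempty subset $S\subseteq T$ with $\prod_{(i,j)\in S}\mathfrak{C}_i=\mathfrak{I}$. Moreover, each such $\beta_l$ is irreducible in $\mathcal{O}_K$.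
   Context: For an ideal class $\mathfrak{C}$ of a number field $K$, a principalization field for $\mathfrak{C}$ is a finite extension $K'$ of $K$ such that for every ideal $\mathfrak{a}\in\mathfrak{C}$, the extended ideal $\mathfrak{a}\mathcal{O}_{K'}$ is principal. Two elements of $\mathcal{O}_L$ are associate in $\mathcal{O}_L$ if they differ by a unit of $\mathcal{O}_L$. ''Minimal'' means no proper nonempty subset $S'\subsetneq S$ has $\prod_{(i,j)\in S'}\mathfrak{C}_i=\mathfrak{I}$. *)

(* Defs.v *)
From HB Require Import structures.
From mathcomp Require Import all_boot all_order all_algebra all_field.
From mathcomp Require Import boolp classical_sets.

Set Implicit Arguments.
Unset Strict Implicit.
Unset Printing Implicit Defensive.

Import GRing.Theory.
Local Open Scope ring_scope.
Local Open Scope classical_set_scope.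
Local Open Scope quotient_scope.

Section Elements.
Variable R : idomainType.

Definition associate (x y : R) : Prop :=
  exists2 u : R, u \is a GRing.unit & x = u * y.

Definition irreducible (x : R) : Prop :=
  [/\ x != 0, x \isn't a GRing.unit
    & forall y z : R, x = y * z ->
        y \is a GRing.unit \/ z \is a GRing.unit].

End Elements.

Section Ideals.
Variable R : idomainType.

Definition is_ideal (I : set R) : Prop :=
  [/\ I 0, forall x y, I x -> I y -> I (x + y)
    & forall a x, I x -> I (a * x)].

Definition ideal_gen (A : set R) : set R := smallest is_ideal A.

Definition principal (a : R) : set R := [set r * a | r in [set: R]].

Definition prime_ideal (I : set R) : Prop :=
  [/\ is_ideal I, ~ I 1 & forall x y, I (x * y) -> I x \/ I y].

(* The zero ideal has no class, so the ideals below are the nonzero ones. *)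
Record nzideal : Type := NzIdeal {
  nzideal_set :> set R;
  nzideal_is_ideal : is_ideal nzideal_set;
  nzideal_neq0 : exists2 x, nzideal_set x & x != 0 }.

HB.instance Definition _ := gen_eqMixin nzideal.
HB.instance Definition _ := gen_choiceMixin nzideal.

Lemma nzidealP (I J : nzideal) : (I : set R) = J -> I = J.
Proof.
case: I J => [I i1 i2] [J j1 j2] /= eIJ; subst J.
by congr NzIdeal; apply: Prop_irrelevance.
Qed.

Lemma ideal_gen_is_ideal (A : set R) : is_ideal (ideal_gen A).
Proof.
split=> [I [[]]|x y Ax Ay I AI|a x Ax I AI] //.
- by case: (AI) => -[_ ID _] _; apply: ID; [apply: Ax|apply: Ay].
- by case: (AI) => -[_ _ IM] _; apply: IM; apply: Ax.
Qed.

Lemma sub_ideal_gen (A : set R) : A `<=` ideal_gen A.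
Proof. by move=> x Ax I [_]; apply. Qed.

Lemma ideal_gen_min (A I : set R) :
  is_ideal I -> A `<=` I -> ideal_gen A `<=` I.
Proof. by move=> iI AI x; apply. Qed.

Lemma principal_is_ideal (a : R) : is_ideal (principal a).
Proof.
split=> [|_ _ [r _ <-] [s _ <-]|b _ [r _ <-]].
- by exists 0; rewrite ?mul0r.
- by exists (r + s); rewrite ?mulrDl.
- by exists (b * r); rewrite ?mulrA.
Qed.

Lemma principalE (a : R) : principal a = ideal_gen [set a].
Proof.
rewrite eqEsubset; split=> [_ [r _ <-]|].
  case: (ideal_gen_is_ideal [set a]) => _ _; apply.
  exact: sub_ideal_gen.
apply: ideal_gen_min; first exact: principal_is_ideal.
by move=> _ ->; exists 1; rewrite ?mul1r.
Qed.

Definition prod_set (I J : set R) : set R :=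
  ideal_gen [set x * y | x in I & y in J].

Lemma prod_set_neq0 (I J : nzideal) : exists2 x, prod_set I J x & x != 0.
Proof.
case: (nzideal_neq0 I) (nzideal_neq0 J) => x Ix x0 [y Jy y0].
exists (x * y); last by rewrite mulf_neq0.
by apply: sub_ideal_gen; exists x => //; exists y.
Qed.

Definition nzideal_mul (I J : nzideal) : nzideal :=
  NzIdeal (ideal_gen_is_ideal _) (prod_set_neq0 I J).

Lemma setT_is_ideal : is_ideal [set: R]. Proof. by []. Qed.

Lemma setT_neq0 : exists2 x, [set: R] x & x != 0.
Proof. by exists 1; rewrite ?oner_eq0. Qed.

Definition nzideal_one : nzideal := NzIdeal setT_is_ideal setT_neq0.

Lemma prod_setC (I J : set R) : prod_set I J = prod_set J I.
Proof.
suff H A B : prod_set A B `<=` prod_set B A by rewrite eqEsubset; split.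
apply: ideal_gen_min; first exact: ideal_gen_is_ideal.
move=> _ [x Ax] [y By] <-; rewrite mulrC.
by apply: sub_ideal_gen; exists y => //; exists x.
Qed.

Lemma prod_setA_sub (I J K : set R) :
  prod_set (prod_set I J) K `<=` prod_set I (prod_set J K).
Proof.
have [h0 hD hM] := ideal_gen_is_ideal [set x * y | x in I & y in prod_set J K].
apply: ideal_gen_min; first exact: ideal_gen_is_ideal.
move=> _ [x Ix] [z Kz] <-.
apply: (Ix [set u | prod_set I (prod_set J K) (u * z)]); split.
  split=> [|u v|a u] /=; first by rewrite mul0r.
  - by rewrite mulrDl; apply: hD.
  - by rewrite -mulrA; apply: hM.
move=> _ [a Ia] [b Jb] <- /=; rewrite -mulrA; apply: sub_ideal_gen.
exists a => //; exists (b * z) => //; apply: sub_ideal_gen.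
by exists b => //; exists z.
Qed.

Lemma nzideal_mulC : commutative nzideal_mul.
Proof. by move=> I J; apply: nzidealP; apply: prod_setC. Qed.

Lemma nzideal_mulA : associative nzideal_mul.
Proof.
move=> I J K; apply: nzidealP; rewrite /= -/(prod_set _ _) eqEsubset.
split; last exact: prod_setA_sub.
change (prod_set I (prod_set J K) `<=` prod_set (prod_set I J) K).
rewrite prod_setC [X in prod_set X]prod_setC.
rewrite (prod_setC I) (prod_setC _ K).
exact: prod_setA_sub.
Qed.

Lemma nzideal_mul1 : left_id nzideal_one nzideal_mul.
Proof.
move=> I; apply: nzidealP; rewrite eqEsubset; split.
- apply: ideal_gen_min; first exact: nzideal_is_ideal.
  move=> _ [a _] [x Ix] <-; case: (nzideal_is_ideal I) => _ _; exact.
- by move=> x Ix; apply: sub_ideal_gen; exists 1 => //; exists x; rewrite ?mul1r.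
Qed.

Lemma nzideal_mulr1 : right_id nzideal_one nzideal_mul.
Proof. by move=> I; rewrite nzideal_mulC nzideal_mul1. Qed.

HB.instance Definition _ := isMonoid.Build nzideal
  nzideal_mulA nzideal_mul1 nzideal_mulr1.
HB.instance Definition _ := SemiGroup.isCommutativeLaw.Build nzideal
  *%g nzideal_mulC.

Definition nzideal_equiv (I J : nzideal) : Prop :=
  exists a b : R, [/\ a != 0, b != 0
    & [set a * x | x in (I : set R)] = [set b * y | y in (J : set R)]].

Lemma nzideal_equiv_refl I : nzideal_equiv I I.
Proof. by exists 1, 1; rewrite oner_eq0. Qed.

Lemma nzideal_equiv_sym I J : nzideal_equiv I J -> nzideal_equiv J I.
Proof. by case=> a [b [a0 b0 e]]; exists b, a. Qed.

Lemma scale_set (a b : R) (A : set R) :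
  [set (a * b) * x | x in A] = [set a * y | y in [set b * x | x in A]].
Proof.
rewrite eqEsubset; split=> [_ [x Ax <-]|_ [_ [x Ax <-] <-]].
- by exists (b * x); [exists x|rewrite mulrA].
- by exists x; rewrite ?mulrA.
Qed.

Lemma nzideal_equiv_trans J I K :
  nzideal_equiv I J -> nzideal_equiv J K -> nzideal_equiv I K.
Proof.
case=> a [b [a0 b0 eIJ]] [c [d [c0 d0 eJK]]].
exists (c * a), (b * d); rewrite !mulf_neq0 //; split=> //.
by rewrite (scale_set c) eIJ -scale_set (mulrC c) (scale_set b c) eJK -scale_set.
Qed.

Definition nzideal_eqb : rel nzideal := fun I J => `[< nzideal_equiv I J >].

Lemma nzideal_eqb_equiv : equiv_class_of nzideal_eqb.
Proof.
split=> [I|I J|J I K].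
- exact/asboolP/nzideal_equiv_refl.
- by apply/asboolP/asboolP; apply: nzideal_equiv_sym.
- by move=> /asboolP h /asboolP k; apply/asboolP/(nzideal_equiv_trans h k).
Qed.

Canonical nzideal_equiv_rel := EquivRelPack nzideal_eqb_equiv.

(* The monoid of nonzero ideals modulo principal ideals.  When R is the ring of
   integers of a number field this is the ideal class group. *)
Definition ideal_class : Type := {eq_quot nzideal_equiv_rel}.
HB.instance Definition _ := Choice.on ideal_class.
HB.instance Definition _ := EqQuotient.on ideal_class.

Definition class_of (I : nzideal) : ideal_class := \pi_ideal_class I.

Lemma class_ofP (I J : nzideal) :
  class_of I = class_of J <-> nzideal_equiv I J.
Proof.
split=> [/(@eqmodP _ nzideal_equiv_rel)/asboolP|h] //.
exact/eqmodP/asboolP.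
Qed.

Lemma class_ofK (c : ideal_class) : class_of (repr c) = c.
Proof. exact: reprK. Qed.

Definition class_mul (c d : ideal_class) : ideal_class :=
  class_of (nzideal_mul (repr c) (repr d)).

Lemma scale_prod_sub (a b : R) (I J I' : set R) :
  [set a * x | x in I] = [set b * y | y in J] ->
  [set a * x | x in prod_set I I'] `<=` [set b * y | y in prod_set J I'].
Proof.
move=> e; have [h0 hD hM] := ideal_gen_is_ideal [set x * y | x in J & y in I'].
move=> _ [x Ix <-].
apply: (Ix [set u | [set b * y | y in prod_set J I'] (a * u)]); split.
  split=> [|u v [y Ay ey] [z Az ez]|r u [y Ay ey]] /=.
  - by exists 0; rewrite ?mulr0.
  - by exists (y + z); [apply: hD|rewrite !mulrDr ey ez].
  - by exists (r * y); [apply: hM|rewrite mulrCA ey mulrCA].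
move=> _ [u Iu] [v Iv] <- /=; rewrite mulrA.
have [w Jw <-] : [set b * y | y in J] (a * u) by rewrite -e; exists u.
exists (w * v); rewrite ?mulrA //.
by apply: sub_ideal_gen; exists w => //; exists v.
Qed.

Lemma nzideal_equivMl (I J K : nzideal) : nzideal_equiv I J ->
  nzideal_equiv (nzideal_mul I K) (nzideal_mul J K).
Proof.
case=> a [b [a0 b0 e]]; exists a, b; split=> //.
by rewrite eqEsubset; split; apply: scale_prod_sub.
Qed.

Lemma nzideal_equivM (I J I' J' : nzideal) :
  nzideal_equiv I J -> nzideal_equiv I' J' ->
  nzideal_equiv (nzideal_mul I I') (nzideal_mul J J').
Proof.
move=> h h'; apply: (@nzideal_equiv_trans (nzideal_mul J I')).
  exact: nzideal_equivMl.
by rewrite !(nzideal_mulC J); apply: nzideal_equivMl.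
Qed.

Lemma class_ofM (I J : nzideal) :
  class_of (nzideal_mul I J) = class_mul (class_of I) (class_of J).
Proof.
by apply/class_ofP; apply: nzideal_equivM; apply/class_ofP; rewrite class_ofK.
Qed.

Lemma class_mulC : commutative class_mul.
Proof. by move=> c d; rewrite /class_mul nzideal_mulC. Qed.

Lemma class_mulA : associative class_mul.
Proof.
move=> c d e; rewrite -(class_ofK c) -(class_ofK d) -(class_ofK e).
by rewrite -!class_ofM nzideal_mulA.
Qed.

Lemma class_mul1 : left_id (class_of nzideal_one) class_mul.
Proof. by move=> c; rewrite -(class_ofK c) -class_ofM nzideal_mul1. Qed.

Lemma class_mulr1 : right_id (class_of nzideal_one) class_mul.
Proof. by move=> c; rewrite class_mulC class_mul1. Qed.

HB.instance Definition _ := isMonoid.Build ideal_class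
  class_mulA class_mul1 class_mulr1.
HB.instance Definition _ := SemiGroup.isCommutativeLaw.Build ideal_class
  *%g class_mulC.

Lemma class_of1P (I : nzideal) :
  class_of I = 1%g <-> exists a : R, (I : set R) = principal a.
Proof.
split=> [/class_ofP [a [b [a0 b0 e]]]|[a eI]].
  have [x Ix ex] : [set a * x | x in (I : set R)] b.
    by rewrite e; exists 1; rewrite ?mulr1.
  exists x; rewrite eqEsubset; split=> [y Iy|_ [r _ <-]]; last first.
    by case: (nzideal_is_ideal I) => _ _; apply.
  have [r _ er] : [set b * y | y in [set: R]] (a * y) by rewrite -e; exists y.
  by exists r => //; apply: (mulfI a0); rewrite -er -ex mulrCA mulrC.
have a0 : a != 0.
  case: (nzideal_neq0 I) => x; rewrite eI => -[r _ <-].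
  by rewrite mulf_eq0 negb_or => /andP[].
apply/class_ofP; exists 1, a; rewrite oner_eq0; split=> //.
rewrite eI eqEsubset; split=> [_ [_ [r _ <-] <-]|_ [r _ <-]].
- by exists r; rewrite // mul1r mulrC.
- by exists (r * a); [exists r|rewrite mul1r mulrC].
Qed.

Section MinimalSubset.
Variables (T : finType) (c : T -> ideal_class).

(* S is a minimal nonempty subset of T whose classes multiply to the class of
   principal ideals, which is 1 by class_of1P. *)
Definition minimal_principal (S : {set T}) : Prop :=
  [/\ S != finset.set0, (\prod_(t in S) c t = 1)%g
    & forall S' : {set T}, S' \proper S -> S' != finset.set0 ->
        (\prod_(t in S') c t <> 1)%g].

End MinimalSubset.

End Ideals.

Definition extended_ideal (R R' : idomainType) (f : R -> R') (I : set R) :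
  set R' := ideal_gen (f @` I).

Section RingOfIntegers.
Variable K : fieldExtType rat.

Definition integral_pred : {pred K} :=
  fun x => `[< integralOver (intr : int -> K) x >].

Lemma integral_predP (x : K) :
  reflect (integralOver (intr : int -> K) x) (x \in integral_pred).
Proof. exact: asboolP. Qed.

Lemma integral_pred_subring : subring_closed integral_pred.
Proof.
split=> [|x y /integral_predP hx /integral_predP hy
        |x y /integral_predP hx /integral_predP hy]; apply/integral_predP.
- exact: integral1.
- exact: integral_sub.
- exact: integral_mul.
Qed.

HB.instance Definition _ :=
  GRing.isSubringClosed.Build K integral_pred integral_pred_subring.

Record int_ring : Type := IntRing {
  int_val :> K;
  int_valP : int_val \in integral_pred }.

HB.instance Definition _ := [isSub for int_val].
HB.instance Definition _ := [Choice of int_ring by <:].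
HB.instance Definition _ := [SubChoice_isSubComNzRing of int_ring by <:].

Definition int_unit : {pred int_ring} :=
  fun x => (x != 0) && ((val x)^-1 \in integral_pred).
Definition int_inv (x : int_ring) : int_ring := insubd x (val x)^-1.

Lemma int_mulVx : {in int_unit, left_inverse 1 int_inv *%R}.
Proof.
move=> x /andP[x0 xV]; apply: val_inj; rewrite rmorphM rmorph1 /=.
rewrite /int_inv val_insubd xV mulVf //.
Qed.

Lemma int_unitPl (x y : int_ring) : y * x = 1 -> int_unit x.
Proof.
move=> yx1; have e : val y * val x = 1 by rewrite -rmorphM yx1 rmorph1.
have x0 : val x != 0.
  by apply: contra_eq_neq e => ->; rewrite mulr0 eq_sym oner_eq0.
apply/andP; split; first by apply: contra_neq x0 => ->; rewrite rmorph0.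
by rewrite -[_^-1]mul1r -e mulfK // (valP y).
Qed.

Lemma int_inv_out : {in [predC int_unit], int_inv =1 id}.
Proof.
move=> x; rewrite inE /= negb_and => h; apply: val_inj.
rewrite /int_inv val_insubd; case: ifPn => // xV.
case/orP: h => [/negPn/eqP ->|]; last by rewrite xV.
by rewrite rmorph0 invr0.
Qed.

HB.instance Definition _ := GRing.ComNzRing_hasMulInverse.Build int_ring
  int_mulVx int_unitPl int_inv_out.

Lemma int_integral_domain : GRing.integral_domain_axiom int_ring.
Proof.
move=> x y xy0; have /eqP : val x * val y = 0 by rewrite -rmorphM xy0 rmorph0.
by rewrite mulf_eq0 => /orP[]/eqP h; apply/orP; [left|right];
  apply/eqP/val_inj; rewrite h rmorph0.
Qed.

HB.instance Definition _ :=
  GRing.ComUnitRing_isIntegral.Build int_ring int_integral_domain.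

End RingOfIntegers.

Notation "''O_' K" := (int_ring K)
  (at level 8, K at level 2, format "''O_' K") : type_scope.

Section IntegersMap.
Variables (K K' : fieldExtType rat) (f : {rmorphism K -> K'}).

Lemma int_map_subproof (x : 'O_K) : f (val x) \in @integral_pred K'.
Proof.
have /integral_predP [q qm qx] := valP x; apply/integral_predP.
exists q => //; have := rmorph_root f qx; rewrite -map_poly_comp.
by congr (root _ _); apply: eq_map_poly => z /=; rewrite rmorph_int.
Qed.

Definition int_map (x : 'O_K) : 'O_K' := IntRing (int_map_subproof x).

Lemma int_map_is_additive : zmod_morphism int_map.
Proof. by move=> x y; apply: val_inj; rewrite /= !rmorphB. Qed.

Lemma int_map_is_multiplicative : monoid_morphism int_map.
Proof. by split=> [|x y]; apply: val_inj; rewrite /= ?rmorph1 ?rmorphM. Qed.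

HB.instance Definition _ :=
  GRing.isZmodMorphism.Build _ _ int_map int_map_is_additive.
HB.instance Definition _ :=
  GRing.isMonoidMorphism.Build _ _ int_map int_map_is_multiplicative.

End IntegersMap.

(* A number field is a fieldExtType rat, and an extension K'/K of number fields
   is given by its embedding f : K -> K'; it is automatically finite. *)
Definition principalization_field (K K' : fieldExtType rat)
    (f : {rmorphism K -> K'}) (c : ideal_class 'O_K) : Prop :=
  forall a : nzideal 'O_K, class_of a = c ->
    exists x : 'O_K', extended_ideal (int_map f) a = principal x.

(* L, with embeddings f of K and g c of the K_ c, is a compositum over K of the
   extensions e c : K -> K_ c: the g c are K-embeddings, and no proper subfield
   of L contains all their images. *)
Definition is_compositum (K : fieldExtType rat) (C : Type)
    (K_ : C -> fieldExtType rat) (e : forall c, {rmorphism K -> K_ c})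
    (L : fieldExtType rat) (f : {rmorphism K -> L})
    (g : forall c, {rmorphism K_ c -> L}) : Prop :=
  (forall (c : C) (x : K), g c (e c x) = f x) /\
  (forall M : {subfield L}, (forall (c : C) (x : K_ c), g c x \in M) ->
     M = fullv :> {vspace L}).

(* Main.v *)
(* Everything but the descent from L to K happens in the monoid of nonzero
   ideals of O_K.  Since the p_t multiply to (n), all products p_S = \prod_S p_t
   are invertible, so they cancel and containment in p_t is divisibility by p_t;
   hence every ideal factor of p_A is p_S for some S <= A.  An element b dividing
   n thus generates some p_S with trivial class, and b is irreducible iff S is
   minimal.  Finally (b) = p_S iff b is associate in O_L to \prod_S alpha_t:
   both ideals extend to principal ideals of O_L, and an invertible ideal of O_K
   is the contraction of its extension because O_L meets K in O_K. *)

Require Import Defs.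
From mathcomp Require Import all_boot all_order all_algebra all_field.
From mathcomp Require Import boolp classical_sets.

Local Open Scope ring_scope.

Set Implicit Arguments.
Unset Strict Implicit.
Unset Printing Implicit Defensive.
Import GRing.Theory.
Local Open Scope classical_set_scope.

Local Identity Coercion set_fun : set >-> Funclass.

(** * Products, principal ideals and invertible ideals in the monoid of nonzero ideals *)

Section ProductsOfIdeals.
Variable R : idomainType.
Implicit Types (I J A B : nzideal R) (a b x y : R).

Lemma mem_prod_set (I J : set R) x y : I x -> J y -> prod_set I J (x * y).
Proof. by move=> Ix Jy; apply: sub_ideal_gen; exists x => //; exists y. Qed.

Lemma prod_set_ind (H I J : set R) z : is_ideal H ->
  (forall x y, I x -> J y -> H (x * y)) -> prod_set I J z -> H z.
Proof.
move=> iH IJH; apply: ideal_gen_min => // _ [x Ix] [y Jy] <-; exact: IJH.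
Qed.

(** Commutativity in the monoid notation [*%g], the form in which products of ideals are rewritten
    below. *)
Lemma nzideal_mulgC I J : (I * J = J * I)%g.
Proof. exact: nzideal_mulC. Qed.

Lemma nzideal_mulr I a x : I x -> I (a * x).
Proof. by case: (nzideal_is_ideal I) => _ _; apply. Qed.

Lemma prod_set_subl I J : prod_set I J `<=` I.
Proof.
move=> z; apply: prod_set_ind => [|x y Ix _]; first exact: nzideal_is_ideal.
by rewrite mulrC; apply: nzideal_mulr.
Qed.

(** The product lies in [I], so [I] is the whole ring as soon as the product is. *)
Lemma mul_nzideal_eq1 I J : (I * J = 1)%g -> I = 1%g.
Proof.
move=> IJ1; apply: nzidealP; rewrite eqEsubset; split=> // x _.
apply: (@prod_set_subl I J); have -> : prod_set I J = (I * J)%g by [].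
by rewrite IJ1.
Qed.

(** If some [x] in [I] lies outside [P], then [x * y] in [P] forces every [y] of [J] into [P]. *)
Lemma prime_prod_set (P : set R) I J : prime_ideal P -> prod_set I J `<=` P ->
  (I `<=` P) \/ (J `<=` P).
Proof.
move=> [_ _ primeP] IJP.
have [|/existsNP[x /not_implyP[Ix Px]]] := pselect (I `<=` P); first by left.
by right=> y Jy; have [] := primeP x y (IJP _ (mem_prod_set Ix Jy)).
Qed.

Lemma principal_neq0 a : a != 0 -> exists2 x, principal a x & x != 0.
Proof. by exists a => //; exists 1; rewrite ?mul1r. Qed.

Definition nzprincipal a (a0 : a != 0) : nzideal R :=
  NzIdeal (principal_is_ideal a) (principal_neq0 a0).

Lemma principal_gen a : principal a a.
Proof. by exists 1; rewrite ?mul1r. Qed.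

(** The multiples [a * y] already form an ideal, so sums of products add nothing. *)
Lemma mem_nzprincipal_mul a (a0 : a != 0) I x :
  (nzprincipal a0 * I)%g x <-> exists2 y, I y & x = a * y.
Proof.
split; last by case=> y Iy ->; apply: mem_prod_set => //; apply: principal_gen.
have [I0 ID IM] := nzideal_is_ideal I.
apply: (@prod_set_ind [set x | exists2 y, I y & x = a * y] (principal a) I).
  split=> [|_ _ [y Iy ->] [z Iz ->]|b _ [y Iy ->]] /=.
  - by exists 0; rewrite ?mulr0.
  - by exists (y + z); rewrite ?mulrDr //; apply: ID.
  - by exists (b * y); [apply: IM|rewrite mulrCA].
move=> _ y [r _ <-] Iy; exists (r * y); first exact: IM.
by rewrite mulrA (mulrC a).
Qed.

(** The proof [ab0] is a parameter, so that the equation applies to whichever proof of nonvanishing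
    occurs. *)
Lemma nzprincipalM a b (a0 : a != 0) (b0 : b != 0) (ab0 : a * b != 0) :
  nzprincipal ab0 = (nzprincipal a0 * nzprincipal b0)%g.
Proof.
apply: nzidealP; rewrite eqEsubset; split=> [_ [r _ <-]|x].
  apply/mem_nzprincipal_mul; exists (r * b); last by rewrite mulrCA.
  by exists r.
by case/mem_nzprincipal_mul=> _ [r _ <-] ->; exists r; rewrite // mulrCA.
Qed.

Lemma nzprincipal_eq1 a (a0 : a != 0) :
  nzprincipal a0 = 1%g <-> a \is a GRing.unit.
Proof.
split=> [a1|ua].
  have [r _ ra1] : nzprincipal a0 1 by rewrite a1.
  by apply/unitrPr; exists r; rewrite mulrC.
apply: nzidealP; rewrite eqEsubset; split=> // x _.
by exists (x / a) => //; rewrite divrK.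
Qed.

Lemma associate_principal x y :
  associate x y <-> principal x = principal y.
Proof.
split=> [[u uu ->]|e].
  rewrite eqEsubset; split=> _ [r _ <-]; first by exists (r * u); rewrite ?mulrA.
  by exists (r / u); rewrite // mulrA divrK.
have [r _ er] : principal y x by rewrite -e; apply: principal_gen.
have [s _ es] : principal x y by rewrite e; apply: principal_gen.
(* The factor [r] is shown to be a unit by cancelling [x]; when [x = 0], also [y = 0] and the unit 1
   serves. *)
have [x0|x0] := eqVneq x 0.
  by exists 1; rewrite ?unitr1 // mul1r x0 -es x0 mulr0.
exists r => //; apply/unitrPr; exists s; apply: (mulIf x0).
by rewrite -mulrA es er mul1r.
Qed.

Lemma class_of_nzprincipal a (a0 : a != 0) : class_of (nzprincipal a0) = 1%g.
Proof. by apply/class_of1P; exists a. Qed.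

Lemma class_of_eq1 I : class_of I = 1%g ->
  exists a (a0 : a != 0), I = nzprincipal a0.
Proof.
case/class_of1P=> a eI.
have a0 : a != 0.
  have [x] := nzideal_neq0 I; rewrite eI => -[r _ <-].
  by rewrite mulf_eq0 negb_or => /andP[].
by exists a, a0; apply: nzidealP.
Qed.

Lemma nzprincipal_mulI a (a0 : a != 0) :
  injective (fun I => nzprincipal a0 * I)%g.
Proof.
suff sub I J : (nzprincipal a0 * I = nzprincipal a0 * J)%g -> I `<=` J.
  by move=> I J eIJ; apply: nzidealP; rewrite eqEsubset; split; apply: sub.
move=> eIJ x Ix.
have : (nzprincipal a0 * I)%g (a * x) by apply/mem_nzprincipal_mul; exists x.
by rewrite eIJ => /mem_nzprincipal_mul[y Jy /(mulfI a0)->].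
Qed.

(** Invertibility as a fractional ideal, with inverse [a^-1 * J], phrased inside [R]. *)
Definition invertible I : Prop :=
  exists J a (a0 : a != 0), (I * J)%g = nzprincipal a0.

Lemma invertible_nzprincipal a (a0 : a != 0) : invertible (nzprincipal a0).
Proof. by exists 1%g, a, a0; rewrite mulg1. Qed.

Lemma invertible_mull I J : invertible (I * J)%g -> invertible I.
Proof. by case=> H [a [a0 e]]; exists (J * H)%g, a, a0; rewrite mulgA. Qed.

(** Multiplying by a partner [H] with [I * H] principal reduces this to cancelling a nonzero
    element. *)
Lemma invertible_mulI I : invertible I -> injective (fun J => I * J)%g.
Proof.
move=> [H [a [a0 eH]]] A B eAB; apply: (@nzprincipal_mulI a a0).
by rewrite -eH (nzideal_mulgC I H) -!mulgA; congr (_ * _)%g.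
Qed.

(** To contain is to divide. With [I * J = (a)] the quotient is [a^-1 * J * A], which lies in [R]
    because [J * A] is contained in [J * I = (a)]. *)
Lemma invertible_dvd I A : invertible I -> A `<=` I -> exists B, A = (I * B)%g.
Proof.
move=> [J [a [a0 eIJ]]] AI.
have JAa x : (J * A)%g x -> exists y, x = a * y.
  apply: (@prod_set_ind [set x | exists y, x = a * y] J A).
    split=> [|_ _ [y ->] [z ->]|b _ [y ->]] /=.
    - by exists 0; rewrite mulr0.
    - by exists (y + z); rewrite mulrDr.
    - by exists (b * y); rewrite mulrCA.
  move=> {}x y Jx Ay; have : (I * J)%g (y * x).
    by apply: mem_prod_set => //; apply: AI.
  by rewrite eIJ => -[r _ e]; exists r; rewrite mulrC -e mulrC.
have iB : is_ideal [set x | (J * A)%g (a * x)].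
  have [I0 ID IM] := nzideal_is_ideal (J * A)%g.
  split=> [|x y|b x] /=; first by rewrite mulr0.
  - by rewrite mulrDr; apply: ID.
  - by rewrite mulrCA; apply: IM.
have nzB : exists2 x, [set x | (J * A)%g (a * x)] x & x != 0.
  have [x JAx x0] := nzideal_neq0 (J * A)%g; have [y ex] := JAa x JAx.
  exists y; first by rewrite /= -ex.
  by apply: contra_neq x0 => y0; rewrite ex y0 mulr0.
exists (NzIdeal iB nzB); apply: (@nzprincipal_mulI a a0).
(* After multiplication by [(a) = I * J] both sides have the factor [I]; what remains is that
   [J * A] is [(a)] times the quotient. *)
rewrite /= -{1}eIJ -mulgA [RHS]mulgA (nzideal_mulgC (nzprincipal a0) I).
rewrite -!mulgA; congr (_ * _)%g; apply: nzidealP.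
rewrite eqEsubset; split=> [x JAx|x /mem_nzprincipal_mul[y By ->] //].
by have [y ex] := JAa x JAx; apply/mem_nzprincipal_mul; exists y; rewrite /= -?ex.
Qed.

End ProductsOfIdeals.

(** * Factors of an invertible product of prime ideals, and irreducibility *)

Section PrimeFactors.
Variables (R : idomainType) (T : finType) (p : T -> nzideal R).
Hypothesis p_prime : forall t, prime_ideal (p t).

(** Any factor [p t] would be the unit ideal, whereas prime ideals are proper. *)
Lemma prod_prime_eq1 (S : {set T}) : (\prod_(t in S) p t = 1)%g -> S = finset.set0.
Proof.
move=> eS; apply/eqP/set0Pn => -[t St].
have [_ p1 _] := p_prime t; apply: p1.
suff -> : p t = 1%g by [].
apply: (@mul_nzideal_eq1 R _ (\prod_(s in S :\ t) p s)%g).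
by rewrite -big_setD1.
Qed.

Lemma invertible_prod (S : {set T}) :
  invertible (\prod_t p t)%g -> invertible (\prod_(t in S) p t)%g.
Proof.
move=> h; apply: (@invertible_mull R _ (\prod_(t | t \notin S) p t)%g).
by rewrite [X in invertible X](_ : _ = (\prod_t p t)%g) // [RHS](bigID (mem S)).
Qed.

Hypothesis prod_invertible : invertible (\prod_t p t)%g.

(** Induction on the size of [A]: a prime [p t] with [t] in [A] contains [I * J], hence divides [I]
    or [J], and cancelling it leaves a product over [A :\ t]. *)
Lemma dvd_prod_prime (A : {set T}) (I J : nzideal R) :
  (I * J = \prod_(t in A) p t)%g ->
  exists2 S : {set T}, S \subset A & I = (\prod_(t in S) p t)%g.
Proof.
have [m] := ubnP #|A|; elim: m A I J => // m IHm A I J leAm eIJ.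
have [eA|[t At]] := set_0Vmem A.
  exists A => //; move: eIJ; rewrite eA big_set0.
  exact: mul_nzideal_eq1.
have eA : (\prod_(s in A) p s = p t * \prod_(s in A :\ t) p s)%g.
  exact: big_setD1.
have pt_inv : invertible (p t).
  by have := invertible_prod [set t]%SET prod_invertible; rewrite big_set1.
have IJpt : prod_set I J `<=` p t.
  have -> : prod_set I J = (I * J)%g by [].
  by rewrite eIJ eA; apply: prod_set_subl.
have lem : (#|A :\ t| < m)%N by rewrite (cardsD1 t A) At in leAm.
have [/(invertible_dvd pt_inv)[I' eI]|/(invertible_dvd pt_inv)[J' eJ]] :=
    prime_prod_set (p_prime t) IJpt.
  have [S sSA eI'] : exists2 S : {set T}, S \subset A :\ t
      & I' = (\prod_(s in S) p s)%g.
    apply: (IHm _ I' J lem); apply: (invertible_mulI pt_inv).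
    by rewrite /= -eA -eIJ eI mulgA.
  exists (t |: S)%SET.
    rewrite finset.subUset finset.sub1set At.
    exact: (fintype.subset_trans sSA (subD1set _ _)).
  rewrite big_setU1 ?eI ?eI' //=.
  by apply/negP => /(fintype.subsetP sSA); rewrite !inE eqxx.
(* Here [p t] divides [J], so [I] itself is a factor of the smaller product and the subset stays as
   it is. *)
have [S sSA eI] : exists2 S : {set T}, S \subset A :\ t
    & I = (\prod_(s in S) p s)%g.
  apply: (IHm _ I J' lem); apply: (invertible_mulI pt_inv).
  rewrite /= -eA -eIJ eJ mulgA (nzideal_mulgC (p t) I).
  by rewrite mulgA.
by exists S => //; apply: (fintype.subset_trans sSA (subD1set _ _)).
Qed.

Lemma class_of_prod (S : {set T}) :
  class_of (\prod_(t in S) p t)%g = (\prod_(t in S) class_of (p t))%g.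
Proof. exact: (big_morph _ (@class_ofM R) erefl). Qed.

(** [(b)] is the product over some [S]. A proper nonempty subset of trivial class, together with its
    complement in [S], would split [b] into two nonunits. *)
Lemma irreducible_prod_prime (b c : R) (b0 : b != 0) (c0 : c != 0) :
  (nzprincipal b0 * nzprincipal c0 = \prod_t p t)%g -> irreducible b ->
  exists2 S : {set T}, minimal_principal (fun t => class_of (p t)) S
    & nzprincipal b0 = (\prod_(t in S) p t)%g.
Proof.
move=> ebc [_ b_nunit b_irr].
have [S _ eS] : exists2 S : {set T}, S \subset [set: T]%SET
    & nzprincipal b0 = (\prod_(t in S) p t)%g.
  apply: (@dvd_prod_prime [set: T]%SET _ (nzprincipal c0)).
  by rewrite ebc; apply: eq_bigl => t; rewrite inE.
exists S => //; split.
- apply/eqP => S0; move/negP: b_nunit; apply.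
  by apply/(nzprincipal_eq1 b0); rewrite eS S0 big_set0.
- by rewrite -class_of_prod -eS class_of_nzprincipal.
move=> S' ltS'S S'n0 c1.
have sS'S := proper_sub ltS'S.
have eSS' : (\prod_(t in S) p t =
    \prod_(t in S') p t * \prod_(t in S :\: S') p t)%g.
  rewrite (big_setID S') /=; congr (_ * _)%g.
  by apply: eq_bigl => t; rewrite (finset.setIidPr sS'S).
(* The complement inherits the trivial class from [(b)] and the product over [S']. *)
have c2 : class_of (\prod_(t in S :\: S') p t)%g = 1%g.
  have := class_of_nzprincipal b0; rewrite eS eSS' class_ofM class_of_prod c1.
  by rewrite class_mul1.
have [y [y0 ey]] : exists y (y0 : y != 0), (\prod_(t in S') p t)%g = nzprincipal y0.
  by apply: class_of_eq1; rewrite class_of_prod.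
have [z [z0 ez]] := class_of_eq1 c2.
have yz0 : y * z != 0 by rewrite mulf_neq0.
have eb : nzprincipal b0 = nzprincipal yz0 by rewrite eS eSS' ey ez -nzprincipalM.
(* This gives [b = r * (y * z)]; the factor [r] is absorbed into [y] before irreducibility is
   applied. *)
have [r _ er] : nzprincipal yz0 b by rewrite -eb; apply: principal_gen.
case: (b_irr (r * y) z); first by rewrite -er mulrA.
  rewrite unitrM => /andP[_ /(nzprincipal_eq1 y0)].
  by rewrite -ey => /prod_prime_eq1/eqP; apply/negP.
move/(nzprincipal_eq1 z0); rewrite -ez => /prod_prime_eq1/eqP.
by rewrite finset.setD_eq0 => sSS'; have := proper_subn ltS'S; rewrite sSS'.
Qed.

(** If [b = y * z], then [(y)] is the product over a subset of [S] with trivial class. Minimality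
    leaves the empty set, making [y] a unit, or [S], making [z] a unit. *)
Lemma minimal_principal_irreducible (b : R) (b0 : b != 0) (S : {set T}) :
  minimal_principal (fun t => class_of (p t)) S ->
  nzprincipal b0 = (\prod_(t in S) p t)%g -> irreducible b.
Proof.
move=> [Sn0 _ Smin] eS; split=> //.
  apply/negP => /(nzprincipal_eq1 b0); rewrite eS => /prod_prime_eq1 S0.
  by rewrite S0 eqxx in Sn0.
move=> y z eb; have yz0 : y * z != 0 by rewrite -eb.
have [y0 z0] : y != 0 /\ z != 0 by move: yz0; rewrite mulf_eq0 negb_or => /andP[].
have eyz : (nzprincipal y0 * nzprincipal z0 = \prod_(t in S) p t)%g.
  by rewrite -eS -(nzprincipalM _ _ yz0); apply: nzidealP; rewrite /= eb.
have [S1 sS1S eS1] := dvd_prod_prime eyz.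
have c1 : (\prod_(t in S1) class_of (p t) = 1)%g.
  by rewrite -class_of_prod -eS1 class_of_nzprincipal.
have [e1|S1n0] := eqVneq S1 finset.set0.
  by left; apply/(nzprincipal_eq1 y0); rewrite eS1 e1 big_set0.
move: sS1S; rewrite finset.subEproper => /orP[/eqP e1|ltS1];
  last by case: (Smin S1 ltS1 S1n0).
right; apply/(nzprincipal_eq1 z0); apply: (@nzprincipal_mulI R y y0).
by rewrite /= eyz mulg1 eS1 e1.
Qed.

End PrimeFactors.

(** * Extension of ideals along a ring morphism, and contraction *)

Section Extension.
Variables (R R' : idomainType) (F : {rmorphism R -> R'}).

Lemma preimage_is_ideal (H : set R') : is_ideal H -> is_ideal [set x | H (F x)].
Proof.
move=> [H0 HD HM]; split=> [|x y|a x] /=; first by rewrite rmorph0.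
- by rewrite rmorphD; apply: HD.
- by rewrite rmorphM; apply: HM.
Qed.

Lemma extended_principal (a : R) : extended_ideal F (principal a) = principal (F a).
Proof.
rewrite eqEsubset; split.
  apply: ideal_gen_min; first exact: principal_is_ideal.
  by move=> _ [_ [r _ <-] <-]; exists (F r); rewrite ?rmorphM.
rewrite principalE; apply: ideal_gen_min; first exact: ideal_gen_is_ideal.
by move=> _ ->; apply: sub_ideal_gen; exists a => //; apply: principal_gen.
Qed.

Lemma extended_ideal_ind (H : set R') (I : set R) z : is_ideal H ->
  (forall x, I x -> H (F x)) -> extended_ideal F I z -> H z.
Proof. by move=> iH IH; apply: ideal_gen_min => // _ [x Ix <-]; apply: IH. Qed.

Lemma mem_extended_ideal (I : set R) x : I x -> extended_ideal F I (F x).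
Proof. by move=> Ix; apply: sub_ideal_gen; exists x. Qed.

(** This is the colon ideal of [H] by [c]; it allows induction on one factor of a product while the
    other is fixed. *)
Lemma scale_preimage_is_ideal (c : R') (H : set R') :
  is_ideal H -> is_ideal [set z | H (c * z)].
Proof.
move=> [H0 HD HM]; split=> [|x y|a x] /=; first by rewrite mulr0.
- by rewrite mulrDr; apply: HD.
- by rewrite mulrCA; apply: HM.
Qed.

Lemma extended_prod_principal (I J : nzideal R) (x y : R') :
  extended_ideal F I = principal x -> extended_ideal F J = principal y ->
  extended_ideal F (I * J)%g = principal (x * y).
Proof.
move=> eI eJ; rewrite eqEsubset; split=> z.
  apply: extended_ideal_ind => [|u]; first exact: principal_is_ideal.
  apply: (@prod_set_ind R [set v | principal (x * y) (F v)] I J).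
    exact/preimage_is_ideal/principal_is_ideal.
  move=> {}u v Iu Jv; rewrite /= rmorphM.
  have [r _ <-] : principal x (F u) by rewrite -eI; apply: mem_extended_ideal.
  have [s _ <-] : principal y (F v) by rewrite -eJ; apply: mem_extended_ideal.
  by exists (r * s); rewrite // mulrACA.
have iIJ : is_ideal (extended_ideal F (I * J)%g) by exact: ideal_gen_is_ideal.
have [_ _ IJM] := iIJ.
case=> r _ <-; apply: IJM.
(* To place [x * y] in the extension of [I * J], first [y] is reduced to some [F v] with [v] in [J],
   then [x] to some [F u] with [u] in [I]. *)
have: extended_ideal F J y by rewrite eJ; apply: principal_gen.
apply: (@extended_ideal_ind [set v | extended_ideal F (I * J)%g (x * v)])
  => [|v Jv] /=.
  exact: scale_preimage_is_ideal.
have: extended_ideal F I x by rewrite eI; apply: principal_gen.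
rewrite mulrC.
apply: (@extended_ideal_ind [set u | extended_ideal F (I * J)%g (F v * u)])
  => [|u Iu] /=.
  exact: scale_preimage_is_ideal.
rewrite mulrC -rmorphM; exact: mem_extended_ideal (mem_prod_set Iu Jv).
Qed.

Lemma extended_big_prod_principal (T : finType) (p : T -> nzideal R) (a : T -> R')
    (S : {set T}) :
  (forall t, extended_ideal F (p t) = principal (a t)) ->
  extended_ideal F (\prod_(t in S) p t)%g = principal (\prod_(t in S) a t).
Proof.
move=> pa.
apply: (big_ind2 (fun (I : nzideal R) x => extended_ideal F I = principal x)) => //.
  have -> : (1%g : nzideal R) = principal 1 :> set R.
    by rewrite eqEsubset; split=> // x _; exists x; rewrite ?mulr1.
  by rewrite extended_principal rmorph1.
by move=> I x J y; apply: extended_prod_principal.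
Qed.

(** A fraction-free form of [O_L] meeting [K] in [O_K]. *)
Hypothesis F_dvd : forall x y z, y != 0 -> F x = F y * z -> exists w, x = y * w.

(* With I J = (a), any y in J satisfies x y R' <= I J R' = a R', so x J <= (a)
   and a x lies in x I J <= a I. *)
Lemma extended_ideal_contract (I : nzideal R) x :
  invertible I -> extended_ideal F I (F x) -> I x.
Proof.
move=> [J [a [a0 eIJ]]] IFx.
have xJ y : J y -> exists w, x * y = a * w.
  move=> Jy.
  have [w _ ew] : principal (F a) (F y * F x).
    move: IFx.
    apply: (@extended_ideal_ind [set z | principal (F a) (F y * z)]) => [|u Iu] /=.
      exact/scale_preimage_is_ideal/principal_is_ideal.
    have : (I * J)%g (u * y) by apply: mem_prod_set.
    by rewrite eIJ => -[r _ e]; exists (F r); rewrite // -!rmorphM e mulrC.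
  apply: (F_dvd (z := w)) => //; by rewrite rmorphM mulrC -ew mulrC.
have : (I * J)%g a by rewrite eIJ; apply: principal_gen.
have [I0 ID IM] := nzideal_is_ideal I.
move/(@prod_set_ind _ [set s | exists2 v, I v & x * s = a * v] I J).
case=> [||v Iv]; last by rewrite mulrC => /(mulfI a0)->.
  split=> [|s s' [v Iv e] [v' Iv' e']|r s [v Iv e]] /=.
  - by exists 0; rewrite ?mulr0.
  - by exists (v + v'); rewrite ?mulrDr ?e ?e' //; apply: ID.
  - by exists (r * v); rewrite ?(mulrCA _ r) ?e //; apply: IM.
move=> u y Iu /xJ[w ew]; exists (u * w); first by rewrite mulrC; apply: IM.
by rewrite mulrCA ew mulrCA.
Qed.

Lemma extended_ideal_inj (I J : nzideal R) : invertible I -> invertible J ->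
  extended_ideal F I = extended_ideal F J -> I = J.
Proof.
move=> vI vJ e; apply: nzidealP; rewrite eqEsubset; split=> x Ax.
  by apply: extended_ideal_contract => //; rewrite -e; apply: mem_extended_ideal.
by apply: extended_ideal_contract => //; rewrite e; apply: mem_extended_ideal.
Qed.

(** Both sides say that [(b)] and the product over [S] have the same extension; for invertible
    ideals this already gives equality. *)
Lemma associate_prod_iff (T : finType) (p : T -> nzideal R) (a : T -> R') :
  invertible (\prod_t p t)%g ->
  (forall t, extended_ideal F (p t) = principal (a t)) ->
  forall (S : {set T}) (b : R) (b0 : b != 0),
    associate (F b) (\prod_(t in S) a t) <->
    nzprincipal b0 = (\prod_(t in S) p t)%g.
Proof.
move=> vp pa S b b0.
have eF := extended_principal b; have eS := extended_big_prod_principal S pa.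
split=> [/associate_principal e|e]; last first.
  by apply/associate_principal; rewrite -eF -eS -e.
apply: extended_ideal_inj; last by rewrite eS -e.
- exact: invertible_nzprincipal.
- exact: invertible_prod.
Qed.

End Extension.

(** * Towers of extensions, and descent for rings of integers *)

Lemma extended_ideal_tower (R R1 R2 : idomainType) (E : {rmorphism R -> R1})
    (G : {rmorphism R1 -> R2}) (F : {rmorphism R -> R2}) (I : set R) (x : R1) :
  (forall r, G (E r) = F r) -> extended_ideal E I = principal x ->
  extended_ideal F I = principal (G x).
Proof.
move=> GE eI; rewrite eqEsubset; split=> z.
  apply: extended_ideal_ind => [|y Iy]; first exact: principal_is_ideal.
  have [r _ er] : principal x (E y) by rewrite -eI; apply: mem_extended_ideal.
  by exists (G r); rewrite // -rmorphM er.
have [_ _ IM] := ideal_gen_is_ideal (F @` I).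
case=> r _ <-; apply: IM.
have : extended_ideal E I x by rewrite eI; apply: principal_gen.
apply: (@extended_ideal_ind _ _ E [set u | extended_ideal F I (G u)]) => [|y Iy] /=.
  exact/preimage_is_ideal/ideal_gen_is_ideal.
by rewrite GE; apply: mem_extended_ideal.
Qed.

(* x / y is integral because its image z in L is. *)
Lemma int_map_dvd (K L : fieldExtType rat) (f : {rmorphism K -> L})
    (x y : 'O_K) (z : 'O_L) :
  y != 0 -> int_map f x = int_map f y * z -> exists w, x = y * w.
Proof.
move=> y0 exyz.
have vy0 : val y != 0.
  by apply: contra_neq y0 => h; apply: val_inj; rewrite h rmorph0.
have efz : f (val x / val y) = val z.
  have e : f (val x) = f (val y) * val z by rewrite [LHS](congr1 val exyz) rmorphM.
  by rewrite rmorphM /= e fmorphV mulrC mulKf // fmorph_eq0.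
have w_int : val x / val y \in @integral_pred K.
  apply/integral_predP; have /integral_predP[q qm qz] := valP z.
  exists q => //; move: qz; rewrite -efz -(fmorph_root f) -map_poly_comp.
  by congr (root _ _); apply: eq_map_poly => k /=; rewrite rmorph_int.
exists (IntRing w_int); apply: val_inj; rewrite rmorphM /=.
by rewrite mulrCA mulfV ?mulr1.
Qed.

Theorem theorem1
  (K : fieldExtType rat) (n : 'O_K)
  (T : finType) (i : T -> ideal_class 'O_K) (p : T -> nzideal 'O_K)
  (K_ : ideal_class 'O_K -> fieldExtType rat)
  (e : forall c : ideal_class 'O_K, {rmorphism K -> K_ c})
  (alpha : forall t : T, 'O_(K_ (i t)))
  (L : fieldExtType rat) (f : {rmorphism K -> L})
  (g : forall c : ideal_class 'O_K, {rmorphism K_ c -> L})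
  (n_neq0 : n != 0) (n_nonunit : n \isn't a GRing.unit)
  (p_prime : forall t : T, prime_ideal (p t))
  (p_class : forall t : T, class_of (p t) = i t)
  (n_fact : nzideal_set (\prod_(t : T) p t)%g = principal n)
  (K_principalizes : forall c : ideal_class 'O_K,
     principalization_field (e c) c)
  (alpha_gen : forall t : T,
     extended_ideal (int_map (e (i t))) (p t) = principal (alpha t))
  (L_compositum : is_compositum e f g) :
  let alphaL (t : T) : 'O_L := int_map (g (i t)) (alpha t) in
  let is_min_product (b : 'O_K) : Prop :=
    exists2 S : {set T}, minimal_principal i S
      & associate (int_map f b) (\prod_(t in S) alphaL t) in
  (forall beta : seq 'O_K,
     (n = \prod_(b <- beta) b /\ (forall b, b \in beta -> irreducible b))
     <->
     (n = \prod_(b <- beta) b /\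
      associate (int_map f (\prod_(b <- beta) b)) (\prod_(t : T) alphaL t) /\
      (forall b, b \in beta -> is_min_product b)))
  /\
  (forall b : 'O_K, is_min_product b -> irreducible b).
Proof.
move=> alphaL is_min_product.
have extL t : extended_ideal (int_map f) (p t) = principal (alphaL t).
  apply: (extended_ideal_tower (E := int_map (e (i t)))) => // r.
  by apply: val_inj; apply: L_compositum.1.
have en : (\prod_t p t)%g = nzprincipal n_neq0 by apply: nzidealP.
have p_inv : invertible (\prod_t p t)%g.
  by rewrite en; apply: invertible_nzprincipal.
have ei : i = fun t => class_of (p t) by apply/funext => t; rewrite p_class.
have assocP := associate_prod_iff (@int_map_dvd _ _ f) p_inv extL.
have min_irr b : is_min_product b -> irreducible b.
  move=> [S Smin bS].
  (* If [b] were 0, the extension of the nonzero ideal [\prod_(t in S) p t] would be zero,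
     contradicting the injectivity of [f]. *)
  have b0 : b != 0.
    apply: contraPneq bS => -> /associate_principal.
    rewrite -(extended_big_prod_principal S extL).
    have [x Ix x0] := nzideal_neq0 (\prod_(t in S) p t)%g.
    move=> e0; have [r _] : principal (int_map f 0) (int_map f x).
      by rewrite e0; apply: mem_extended_ideal.
    rewrite rmorph0 mulr0 => /(congr1 val)/esym/eqP.
    by rewrite fmorph_eq0 => /eqP vx0; case/eqP: x0; apply: val_inj.
  apply: (@minimal_principal_irreducible _ _ p p_prime p_inv b b0 S).
    by rewrite -ei.
  exact/assocP.
split=> // beta; split=> [[en' irr]|[en' [_ minb]]]; last first.
  by split=> // b /minb/min_irr.
split=> //; split.
  (* [assocP] speaks of products over a subset, so the product over all of [T] is recast as one over
     the full set. *)
  have inT : (fun t : T => t \in [set: T]%SET) =1 xpredT by move=> t; rewrite inE.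
  by rewrite -en' -(eq_bigl _ _ inT); apply/(assocP _ _ n_neq0);
    rewrite -en (eq_bigl _ _ inT).
move=> b bbeta.
(* The cofactor is the product of the other entries of [beta]; it exhibits [(b)] as a factor of
   [(n)]. *)
have [c enbc] : exists c, n = b * c.
  by exists (\prod_(x <- rem b beta) x); rewrite en' (big_rem b).
have [b0 c0] : b != 0 /\ c != 0.
  by apply/andP; rewrite -negb_or -mulf_eq0 -enbc.
have bc0 : b * c != 0 by rewrite mulf_neq0.
have ebc : (nzprincipal b0 * nzprincipal c0 = \prod_t p t)%g.
  by rewrite -(nzprincipalM _ _ bc0) en; apply: nzidealP; rewrite /= enbc.
have [S Smin eS] := irreducible_prod_prime p_prime p_inv ebc (irr b bbeta).
by exists S; [rewrite ei|apply/(assocP _ _ b0)].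
Qed.
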